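(* Let $X$ and $Y$ be Banach spaces, and let $n\in\mathbb{N}$. If $Y$ has the Radon-Nikodým property, then $\mathrm{QNA}(\mathcal{P}(^nX;Y))$ is dense in $\mathcal{P}(^nX;Y)$.
   Context: Banach spaces are over $\mathbb{K}=\mathbb{R}$ or $\mathbb{C}$; $B_X$ is the closed unit ball of $X$. A map $P\colon X\to Y$ is a continuous $n$-homogeneous polynomial if there is a bounded symmetric $n$-linear map $\check P\colon X\times\cdots\times X\to Y$ with $P(x)=\check P(x,\ldots,x)$ for all $x\in X$. $\mathcal{P}(^nX;Y)$ is the space of all continuous $n$-homogeneous polynomials from $X$ to $Y$ with the norm $\|P\|=\sup_{x\in B_X}\|P(x)\|$. $P$ quasi attains its norm, $P\in\mathrm{QNA}(\mathcal{P}(^nX;Y))$, if there are a sequence $(x_m)\subseteq B_X$ and a point $u\in Y$ with $\|u\|=\|P\|$ such that $P(x_m)\to u$. A Banach space has the Radon-Nikodým property (RNP) if every nonempty bounded subset of it is dentable, where a set $A$ is dentable if for every $\delta>0$ there is $a\in A$ not belonging to the closed convex hull of $A\setminus\{b:\|b-a\|<\delta\}$. *)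

(* Defs.v *)
From HB Require Import structures.
From mathcomp Require Import all_boot all_order all_algebra perm complex.
From mathcomp Require Import all_classical all_reals all_analysis.

Set Implicit Arguments.
Unset Strict Implicit.
Unset Printing Implicit Defensive.

Import Order.TTheory GRing.Theory Num.Theory.
Import numFieldNormedType.Exports.

Local Open Scope classical_set_scope.
Local Open Scope ring_scope.

(* Everything is stated over a numFieldType K so as to be instantiated both with
   K = R and with K = R[i].  In R[i], x <= y means that y - x is a nonnegative
   real, so radii and bounds are real numbers in both cases. *)

Definition unit_ball (K : numFieldType) (X : normedModType K) : set X :=
  [set x | `|x| <= 1].
Arguments unit_ball {K} X.

Section Dentability.
Variables (K : numFieldType) (Y : normedModType K).

(* A convex combination uses coefficients t in K with 0 <= t <= 1; these are
   real when K = R[i]. *)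
Definition closed_convex_hull (A : set Y) : set Y :=
  smallest [set C : set Y | closed C /\ convex_set C] A.

Definition dentable (A : set Y) : Prop :=
  forall delta : K, 0 < delta ->
    exists2 a, A a &
      ~ closed_convex_hull (A `\` [set b | `|b - a| < delta]) a.

Definition radon_nikodym_property : Prop :=
  forall A : set Y, A !=set0 -> bounded_set A -> dentable A.

End Dentability.
Arguments radon_nikodym_property {K} Y.

Section HomogeneousPolynomials.
Variables (K : numFieldType) (X Y : normedModType K) (n : nat).

Definition multilinear (A : ('I_n -> X) -> Y) : Prop :=
  forall (v : 'I_n -> X) (i : 'I_n), linear (fun x : X => A (dfwith v i x)).

Definition symmetric_map (A : ('I_n -> X) -> Y) : Prop :=
  forall (s : {perm 'I_n}) (v : 'I_n -> X), A (v \o s) = A v.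

Definition bounded_multilinear (A : ('I_n -> X) -> Y) : Prop :=
  multilinear A /\
  [bounded A v | v in [set v : 'I_n -> X | forall i, unit_ball X (v i)]].

Definition homogeneous_poly : set (X -> Y) :=
  [set P | exists A : ('I_n -> X) -> Y,
     [/\ bounded_multilinear A, symmetric_map A &
         forall x, P x = A (fun=> x)]].

(* For K = R[i] the supremum is taken for the partial order of R[i]; for a
   nonempty bounded set of reals it is the usual one. *)
Definition poly_norm (P : X -> Y) : K :=
  supremum 0 [set `|P x| | x in unit_ball X].

Definition QNA : set (X -> Y) :=
  [set P | homogeneous_poly P /\
     exists (x : nat -> X) (u : Y),
       [/\ forall m, unit_ball X (x m), `|u| = poly_norm P &
           P (x m) @[m --> \oo] --> u]].

Definition dense_in_homogeneous_poly (S : set (X -> Y)) : Prop :=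
  forall P, homogeneous_poly P -> forall eps : K, 0 < eps ->
    exists2 Q, (homogeneous_poly `&` S) Q & poly_norm (P \- Q) < eps.

End HomogeneousPolynomials.
Arguments homogeneous_poly {K} X Y n.
Arguments QNA {K} X Y n.
Arguments dense_in_homogeneous_poly {K X Y} n S.

(* Main.v *)
(* Let D consist of the unimodular multiples of the values of P on the unit ball.
   Stegall's variational principle gives a functional F of small norm and a limit
   y of points u_k of D such that |d| + |F d| <= |y| + |F y| on D.  Choose z with
   |z| <= 1 and |y + F(y) z| = |y| + |F y|.  Then Q = P + (F o P) z is close to P
   and bounded by |y| + |F y| on the ball, and it approaches a vector of this norm
   along a subsequence on which the unimodular factors of the u_k converge.

   Stegall's principle itself follows by shrinking slices {phi + g > s}, once
   every phi bounded above on a bounded set D has a small slice after adding a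
   functional of norm <= eta.  Let psi be the concave eta-Lipschitz envelope of
   phi, and call a flat if psi x <= psi a + k|x - a| for some fixed k < eta/2.  If
   no small slice exists, Hahn-Banach writes (a, psi a) approximately as a
   barycenter of points (d, phi d) with d far from a.  Ekeland's principle moves
   each d to a flat point at a cost which is paid by an increase of psi; since a
   is flat, the mean displacement must be negligible.  Hence the set of flat
   points, which is bounded and nonempty, is not dentable. *)

Require Import Defs.
From HB Require Import structures.
From mathcomp Require Import all_boot all_order all_algebra perm complex.
From mathcomp Require Import all_classical all_reals all_analysis.
From mathcomp Require Import ring lra.

Set Implicit Arguments.
Unset Strict Implicit.
Unset Printing Implicit Defensive.

Import Order.TTheory GRing.Theory Num.Theory.
Import numFieldNormedType.Exports.

Local Open Scope classical_set_scope.
Local Open Scope ring_scope.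

(** * The Hahn-Banach theorem *)

Section HahnBanach.
Variable R : realType.

Lemma le_infD (A B : set R) (c : R) : A !=set0 -> B !=set0 ->
  (forall a b, A a -> B b -> c <= a + b) -> c <= inf A + inf B.
Proof.
move=> A0 B0 cAB; rewrite -lerBlDr; apply: lb_le_inf => // a Aa.
rewrite lerBlDr -lerBlDl; apply: lb_le_inf => // b Bb.
by rewrite lerBlDl; exact: cAB.
Qed.

Lemma le_infM (A : set R) (t c : R) : A !=set0 -> 0 <= t ->
  (forall a, A a -> c <= t * a) -> c <= t * inf A.
Proof.
move=> A0; rewrite le_eqVlt => /orP[/eqP <-|t0] cA.
  by have [a /cA] := A0; rewrite !mul0r.
rewrite mulrC -ler_pdivrMr//; apply: lb_le_inf => // a Aa.
by rewrite ler_pdivrMr// mulrC; exact: cA.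
Qed.

Variable V : lmodType R.

(* The inequality for all t >= 0 is equivalent to positive homogeneity. *)
Definition sublinear (p : V -> R) : Prop :=
  (forall x y, p (x + y) <= p x + p y) /\
  (forall t x, 0 <= t -> p (t *: x) <= t * p x).

Lemma sublinear0 p : sublinear p -> p 0 = 0.
Proof.
move=> [pD pZ]; apply/eqP; rewrite eq_le; apply/andP; split.
  by have := pZ 0 0 (lexx _); rewrite scale0r mul0r.
by have := pD 0 0; rewrite addr0; lra.
Qed.

Lemma sublinearN_ge p x : sublinear p -> - p (- x) <= p x.
Proof.
move=> sp; have := sp.1 x (- x); rewrite subrr sublinear0//; lra.
Qed.

Lemma sublinearZ p t x : sublinear p -> 0 <= t -> p (t *: x) = t * p x.
Proof.
move=> sp; rewrite le_eqVlt => /orP[/eqP <-|t0].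
  by rewrite scale0r mul0r sublinear0.
apply/eqP; rewrite eq_le sp.2 ?(ltW t0)//=.
have := sp.2 t^-1 (t *: x); rewrite invr_ge0 ltW// => /(_ isT).
by rewrite scalerA mulVf ?gt_eqF// scale1r ler_pdivlMl.
Qed.

(** This serves the chains in Zorn's lemma: of two members of [F] the smaller one handles both
    summands, and [l] keeps the infima finite. *)
Lemma sublinear_inf (F : set (V -> R)) (l : V -> R) : F !=set0 ->
  (forall q, F q -> sublinear q) -> (forall q x, F q -> l x <= q x) ->
  (forall q1 q2, F q1 -> F q2 ->
    (forall x, q1 x <= q2 x) \/ (forall x, q2 x <= q1 x)) ->
  sublinear (fun x => inf [set q x | q in F]).
Proof.
move=> [q0 Fq0] sF lF totF.
have lb x : has_lbound [set q x | q in F].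
  by exists (l x) => _ [q Fq <-]; exact: lF.
have ne x : [set q x | q in F] !=set0 by exists (q0 x), q0.
split=> [x y|t x t0].
  apply: le_infD => // _ _ [q1 F1 <-] [q2 F2 <-].
  have [q12|q21] := totF _ _ F1 F2.
    apply: (@le_trans _ _ (q1 (x + y))).
      by apply: ge_inf => //; exists q1.
    by apply: le_trans ((sF _ F1).1 x y) _; rewrite lerD2l.
  apply: (@le_trans _ _ (q2 (x + y))); first by apply: ge_inf => //; exists q2.
  by apply: le_trans ((sF _ F2).1 x y) _; rewrite lerD2r.
apply: le_infM => // _ [q Fq <-].
apply: (@le_trans _ _ (q (t *: x))); first by apply: ge_inf => //; exists q.
exact: (sF _ Fq).2.
Qed.

(** The infimum over [t >= 0] of [q (x + t *: x0) - t * q x0] is sublinear and, by [t = 0], at most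
    [q]. Minimality and the choice [t = 1] at the point [- x0] then give [q (- x0) <= - q x0]. *)
Lemma minimal_sublinear_odd (q : V -> R) : sublinear q ->
  (forall q', sublinear q' -> (forall x, q' x <= q x) ->
     forall x, q x <= q' x) ->
  forall x, q (- x) = - q x.
Proof.
move=> sq qmin x0.
pose S x := [set q (x + t *: x0) - t * q x0 | t in [set t | 0 <= t]].
have lb x : has_lbound (S x).
  exists (- q (- x)) => _ [t t0 <-].
  have := sq.1 (- x) (x + t *: x0).
  by rewrite addKr (sublinearZ _ sq)//; lra.
have ne x : S x !=set0 by exists (q (x + 0 *: x0) - 0 * q x0), 0 => /=.
have sq' : sublinear (fun x => inf (S x)).
  split=> [x y|t x t0].
    apply: le_infD => // _ _ [s s0 <-] [t t0 <-].
    apply: (@le_trans _ _ (q ((x + y) + (s + t) *: x0) - (s + t) * q x0)).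
      by apply: ge_inf => //; exists (s + t) => //=; exact: addr_ge0.
    rewrite scalerDl addrACA.
    by have := sq.1 (x + s *: x0) (y + t *: x0); lra.
  apply: le_infM => // _ [s s0 <-].
  apply: (@le_trans _ _ (q (t *: x + (t * s) *: x0) - (t * s) * q x0)).
    by apply: ge_inf => //; exists (t * s) => //=; exact: mulr_ge0.
  by rewrite -scalerA -scalerDr sublinearZ// mulrBr mulrA.
have /(qmin _ sq') /(_ (- x0)) le1 : forall x, inf (S x) <= q x.
  move=> x; apply: ge_inf => //; exists 0 => //=.
  by rewrite scale0r addr0 mul0r subr0.
have le2 : inf (S (- x0)) <= - q x0.
  apply: ge_inf => //; exists 1; rewrite /= ?ler01//.
  by rewrite scale1r addNr sublinear0// mul1r sub0r.
apply/eqP; rewrite eq_le (le_trans le1 le2)/=.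
by have := sublinearN_ge x0 sq; lra.
Qed.

Lemma hahn_banach (p : V -> R) : sublinear p ->
  exists2 g : V -> R, linear (g : V -> R^o) & forall x, g x <= p x.
Proof.
move=> sp.
pose T := {q : V -> R | sublinear q /\ forall x, q x <= p x}.
(* The order is reversed, so that Zorn's lemma yields a minimal sublinear functional, which is odd
   and hence linear. *)
pose le (q1 q2 : T) : bool := `[< forall x, sval q2 x <= sval q1 x >].
have := @ZL_preorder T (exist _ p (conj sp (fun x => lexx _))) le.
case=> [q|r s t /asboolP rs /asboolP st|A totA|].
- exact/asboolP.
- by apply/asboolP => x; exact: le_trans (st x) (rs x).
- have [->|/set0P A0] := eqVneq A set0.
    by exists (exist _ p (conj sp (fun x => lexx _))).
  pose F := [set sval q | q in A].
  have F0 : F !=set0 by have [q Aq] := A0; exists (sval q), q.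
  have lF q x : F q -> - p (- x) <= q x.
    move=> [[q' /= [sq' q'p]] Aq <-] /=.
    by apply: le_trans (sublinearN_ge _ sq'); rewrite lerN2.
  have lb x : has_lbound [set q x | q in F].
    by exists (- p (- x)) => _ [q Fq <-]; exact: lF.
  have sI : sublinear (fun x => inf [set q x | q in F]).
    apply: sublinear_inf (lF) _ => //.
      by move=> _ [[q' /= [sq' q'p]] Aq <-].
    move=> _ _ [q1 A1 <-] [q2 A2 <-].
    by have [/asboolP|/asboolP] := totA _ _ A1 A2; [right|left].
  have Ip x : inf [set q x | q in F] <= p x.
    have [q Aq] := A0; apply: le_trans ((svalP q).2 x).
    by apply: ge_inf => //; exists (sval q) => //; exists q.
  exists (exist (fun q => sublinear q /\ forall x, q x <= p x) _ (conj sI Ip)).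
  move=> q Aq; apply/asboolP => x /=.
  by apply: ge_inf => //; exists (sval q) => //; exists q.
move=> [q [sq qp]] qmax; exists q => //.
have qN : forall x, q (- x) = - q x.
  apply: minimal_sublinear_odd => // q' sq' q'q x.
  have q'p y : q' y <= p y by exact: le_trans (q'q y) (qp y).
  by have /asboolP := qmax
    (exist (fun q => sublinear q /\ forall x, q x <= p x) _ (conj sq' q'p))
    (introT (asboolP _) q'q).
have qD x y : q (x + y) = q x + q y.
  apply/eqP; rewrite eq_le sq.1/= -lerBrDr -qN.
  by have := sq.1 (x + y) (- y); rewrite addrK.
have qZ t x : q (t *: x) = t * q x.
  have [t0|t0] := leP 0 t; first exact: sublinearZ.
  rewrite -[t]opprK scaleNr qN sublinearZ ?mulNr// oppr_ge0; exact: ltW.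
by move=> t x y /=; rewrite qD qZ.
Qed.

(** A pair in the convex cone [C] is a constraint [g x <= r]. Hahn-Banach is applied to the infimum
    of [p (v - x) + r] over [C], a sublinear functional which encodes [p] and all the constraints at
    once. *)
Lemma mazur_orlicz (p : V -> R) (C : V -> R -> Prop) : sublinear p ->
  C 0 0 ->
  (forall x y r s, C x r -> C y s -> C (x + y) (r + s)) ->
  (forall t x r, 0 <= t -> C x r -> C (t *: x) (t * r)) ->
  (forall x r, C x r -> 0 <= p (- x) + r) ->
  exists g : V -> R, [/\ linear (g : V -> R^o), forall x, g x <= p x &
    forall x r, C x r -> g x <= r].
Proof.
move=> sp C0 CD CZ Cp.
pose S v := [set p (v - xr.1) + xr.2 | xr in [set xr : V * R | C xr.1 xr.2]].
have lb v : has_lbound (S v).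
  exists (- p (- v)) => _ [[x r] /= Cxr <-].
  have := sp.1 (- v) (v - x); rewrite addKr.
  by have := Cp _ _ Cxr; lra.
have ne v : S v !=set0 by exists (p (v - 0) + 0), (0, 0).
have [|g lg gS] := @hahn_banach (fun v => inf (S v)).
  split=> [u v|t v t0].
    apply: le_infD => // _ _ [[x r] /= Cx <-] [[y s] /= Cy <-].
    apply: (@le_trans _ _ (p ((u + v) - (x + y)) + (r + s))).
      by apply: ge_inf => //; exists (x + y, r + s) => //=; exact: CD.
    by have := sp.1 (u - x) (v - y); rewrite opprD addrACA; lra.
  apply: le_infM => // _ [[x r] /= Cx <-].
  apply: (@le_trans _ _ (p (t *: v - t *: x) + t * r)).
    by apply: ge_inf => //; exists (t *: x, t * r) => //=; exact: CZ.
  by rewrite -scalerBr sublinearZ// mulrDr.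
exists g; split=> // [x|x r Cxr]; apply: le_trans (gS _) _; apply: ge_inf => //.
  by exists (0, 0) => //=; rewrite subr0 addr0.
by exists (x, r) => //=; rewrite subrr sublinear0// add0r.
Qed.

End HahnBanach.

(** * Ekeland's variational principle *)

Section Ekeland.
Variables (R : realType) (V : completeNormedModType R).

Lemma ekeland (f : V -> R) (M k : R) : continuous f -> (forall x, f x <= M) ->
  0 < k -> forall x0, exists x1, f x0 + k * `|x1 - x0| <= f x1 /\
    forall x, f x <= f x1 + k * `|x - x1|.
Proof.
move=> fc fM k0 x0.
(* [S u] collects the points whose gain over [u] pays [k] per unit of distance; [s u] will realize
   at least half of the gain available in [S u]. *)
pose S u := [set x | f u + k * `|x - u| <= f x].
have Suu u : S u u by rewrite /S /= subrr normr0 mulr0 addr0.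
have Strans u v w : S u v -> S v w -> S u w.
  rewrite /S /= => uv vw.
  have := ler_distD v w u; rewrite -(ler_pM2l k0) mulrDr; lra.
have /choice[s sS] : forall u, exists v, S u v /\
    forall x, S u x -> f u + f x <= 2 * f v.
  move=> u.
  have hs : has_sup [set f x | x in S u].
    by split; [exists (f u), u|exists M => _ [x _ <-]].
  have le_sup x : S u x -> f x <= sup [set f x | x in S u].
    by move=> Sx; apply: ub_le_sup; [exact: hs.2|exists x].
  have := le_sup _ (Suu u); rewrite le_eqVlt => /orP[/eqP e|lt].
    exists u; split=> // x /le_sup; rewrite -e; lra.
  pose e := (sup [set f x | x in S u] - f u) / 2.
  have e0 : 0 < e by rewrite divr_gt0// subr_gt0.
  have [_ [v Sv <-]] := sup_adherent e0 hs; rewrite /e => ltv.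
  exists v; split=> // x /le_sup; lra.
pose u n := iter n s x0.
have uS n m : (n <= m)%N -> S (u n) (u m).
  elim: m => [|m IH]; first by rewrite leqn0 => /eqP ->.
  rewrite leq_eqVlt => /orP[/eqP ->//|/IH unm].
  by apply: Strans unm _; exact: (sS (u m)).1.
have fu n m : (n <= m)%N -> f (u n) <= f (u m).
  move=> /uS; apply: le_trans; rewrite lerDl mulr_ge0//; exact: ltW.
have fucvg : cvgn (f \o u).
  apply: nondecreasing_is_cvgn => [n m /fu//|].
  by exists M => _ [n _ <-] /=.
(* For [N <= m], [k * |u m - u N|] is at most [f (u m) - f (u N)], and these values increase to a
   limit. *)
have ucvg : cvgn u.
  apply/cauchy_cvgP; apply: cauchy_exP => e e0.
  pose L := limn (f \o u).
  have fuL n : f (u n) <= L by exact: nondecreasing_cvgn_le.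
  have /cvgrPdist_lt/(_ (k * e)) : f \o u @ \oo --> L by [].
  rewrite mulr_gt0// => /(_ isT) [N _ /(_ N (leqnn N))] /=.
  rewrite ger0_norm ?subr_ge0// => LN.
  exists (u N); exists N => // m /= Nm; rewrite -ball_normE /=.
  rewrite -(ltr_pM2l k0) distrC.
  have := uS _ _ Nm; rewrite /S /=; have := fuL m; lra.
pose l := limn u.
have ul : u @ \oo --> l by [].
have ful : (f \o u) @ \oo --> f l by apply: cvg_comp ul _; exact: fc.
have uSl n : S (u n) l.
  rewrite /S /=.
  have c1 : (fun m => f (u n) + k * `|u m - u n|) @ \oo -->
      f (u n) + k * `|l - u n|.
    apply: cvgD; first exact: cvg_cst.
    apply: cvgM; first exact: cvg_cst.
    by apply: cvg_norm; apply: cvgB => //; exact: cvg_cst.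
  by apply: (ler_cvg_to c1 ful); exists n => // m /uS.
exists l; split; first exact: (uSl 0%N).
move=> x; rewrite leNgt; apply/negP => ltx.
have Slx : S l x by exact: ltW.
(* A better [x] would lie in every [S (u n)]; the limit of the halving inequality gives
   [f x <= f l]. *)
have fxu n : f x + f (u n) <= 2 * f (u n.+1).
  rewrite addrC; apply: (sS (u n)).2; exact: Strans (uSl n) Slx.
have : f x + f l <= 2 * f l.
  have c1 : (fun n => f x + f (u n)) @ \oo --> f x + f l.
    exact: (cvgD (cvg_cst _) ful).
  have c2 : (fun n => 2 * f (u n.+1)) @ \oo --> 2 * f l.
    apply: cvgM; first exact: cvg_cst.
    by rewrite -(cvg_shiftS (f \o u)) in ful.
  apply: (ler_cvg_to c1 c2); exact: nearW.
have : 0 <= k * `|x - l| by rewrite mulr_ge0// ltW.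
lra.
Qed.

End Ekeland.

(** * Concave Lipschitz envelopes *)

Lemma linear_formP (K : nzRingType) (V : lmodType K) (g : V -> K) :
  linear (g : V -> K^o) ->
  [/\ forall x y, g (x + y) = g x + g y, forall t x, g (t *: x) = t * g x &
    forall x, g (- x) = - g x].
Proof.
move=> lg.
have gD x y : g (x + y) = g x + g y.
  by have := lg 1 x y; rewrite !scale1r.
have gZ t x : g (t *: x) = t * g x.
  have g0 : g 0 = 0 by apply: (addrI (g 0)); rewrite -gD !addr0.
  by have := lg t x 0; rewrite !addr0 g0 addr0.
by split=> // x; rewrite -scaleN1r gZ mulN1r.
Qed.

Section GraphHull.
Variables (R : realType) (V : normedModType R).

Lemma norm_sublinear (k : R) : 0 <= k -> sublinear (fun x : V => k * `|x|).
Proof.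
move=> k0; split=> [x y|t x t0]; first by rewrite -mulrDr ler_wpM2l// ler_normD.
by rewrite normrZ ger0_norm// mulrCA.
Qed.

Lemma linear_normP (g : V -> R) (k : R) : linear (g : V -> R^o) ->
  (forall x, g x <= k * `|x|) -> forall x, `|g x| <= k * `|x|.
Proof.
move=> /linear_formP[_ _ gN] gk x.
by rewrite ler_norml gk andbT lerNl -gN -[`|x|]normrN.
Qed.

Lemma le_lipschitz_continuous (f : V -> R) (k : R) : 0 <= k ->
  (forall x y, f x <= f y + k * `|x - y|) -> continuous f.
Proof.
move=> k0 fk x; apply/cvgrPdist_le => e e0.
have k1 : 0 < k + 1 by rewrite ltr_wpDl.
have /cvgrPdist_le/(_ (e / (k + 1))) : z @[z --> x] --> x by exact: cvg_id.
rewrite divr_gt0// => /(_ isT); apply: filterS => y xy.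
have : k * `|x - y| <= e.
  move: xy; rewrite ler_pdivlMr// mulrDr mulr1 mulrC.
  by have := normr_ge0 (x - y); lra.
have := fk x y; have := fk y x.
by rewrite [`|y - x|]distrC ler_norml; lra.
Qed.

Definition convex_graph (C : V -> R -> Prop) : Prop :=
  forall t x r y s, 0 <= t -> t <= 1 -> C x r -> C y s ->
    C (t *: x + (1 - t) *: y) (t * r + (1 - t) * s).

(** The convex hull of the graph, encoded impredicatively: membership is its own induction principle
    over convex relations [C]. *)
Definition graph_hull (B : set V) (phi : V -> R) (x : V) (r : R) : Prop :=
  forall C, convex_graph C -> (forall d, B d -> C d (phi d)) -> C x r.

Lemma graph_hull_convex B phi : convex_graph (graph_hull B phi).
Proof.
move=> t x r y s t0 t1 Hx Hy C cC BC.
exact: (cC _ _ _ _ _ t0 t1 (Hx C cC BC) (Hy C cC BC)).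
Qed.

Lemma graph_hull_sub B phi d : B d -> graph_hull B phi d (phi d).
Proof. by move=> Bd C _; exact. Qed.

Lemma graph_hull_affine B phi (g : V -> R) c : linear (g : V -> R^o) ->
  (forall d, B d -> phi d + g d <= c) ->
  forall x r, graph_hull B phi x r -> r + g x <= c.
Proof.
move=> lg Bc x r /(_ (fun x r => r + g x <= c)); apply=> // {x r}.
move=> t x r y s t0 t1 xr ys.
have [gD gZ _] := linear_formP lg.
rewrite gD !gZ.
have : t * (r + g x) <= t * c by rewrite ler_wpM2l.
have : (1 - t) * (s + g y) <= (1 - t) * c by rewrite ler_wpM2l// subr_ge0.
lra.
Qed.

Lemma graph_hull_separation B phi (a : V) (c k : R) : B !=set0 -> 0 <= k ->
  (forall x r, graph_hull B phi x r -> r <= c + k * `|x - a|) ->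
  exists g : V -> R, [/\ linear (g : V -> R^o),
    forall x, `|g x| <= k * `|x| & forall d, B d -> phi d + g (d - a) <= c].
Proof.
move=> [b0 Bb0] k0 Hk.
(* The cone spanned by the pairs [(b - a, c - t)]; the bound [Hk] is exactly its compatibility with
   [k * |x|]. *)
pose C x r := exists l b t, [/\ 0 <= l, graph_hull B phi b t,
  x = l *: (b - a) & r = l * (c - t)].
have [|||||g [lg gk gC]] := @mazur_orlicz R V (fun x => k * `|x|) C.
- exact: norm_sublinear.
- exists 0, b0, (phi b0); split=> //; first exact: graph_hull_sub.
    by rewrite scale0r.
  by rewrite mul0r.
- move=> _ _ _ _ [l [b [t [l0 Hb -> ->]]]] [m [b' [t' [m0 Hb' -> ->]]]].
  (* If both multiples vanish, the weight [l / (l + m)] is meaningless, and any hull point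
     represents the sum. *)
  have [lm0|lm0] := eqVneq (l + m) 0.
    have l00 : l = 0 by lra.
    have m00 : m = 0 by lra.
    exists 0, b, t; split=> //; first by rewrite l00 m00 !scale0r addr0.
    by rewrite l00 m00 !mul0r addr0.
  have lmp : 0 < l + m by rewrite lt_neqAle eq_sym lm0 addr_ge0.
  have E : 1 - l / (l + m) = m / (l + m) by field.
  exists (l + m), ((l / (l + m)) *: b + (1 - l / (l + m)) *: b'),
    (l / (l + m) * t + (1 - l / (l + m)) * t'); split.
  + exact: ltW.
  + apply: graph_hull_convex => //; first by rewrite divr_ge0// ltW.
    by rewrite ler_pdivrMr// mul1r lerDl.
  + rewrite E [in RHS]scalerBr [in RHS]scalerDr !scalerA.
    rewrite !(mulrCA (l + m)) divff// !mulr1.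
    by rewrite !scalerBr scalerDl opprD addrACA.
  + by rewrite E; field.
- move=> t _ _ t0 [l [b [s [l0 Hb -> ->]]]]; exists (t * l), b, s; split=> //.
  + exact: mulr_ge0.
  + by rewrite scalerA.
  + by rewrite mulrA.
- move=> _ _ [l [b [t [l0 Hb -> ->]]]].
  rewrite normrN normrZ ger0_norm// mulrCA -mulrDr mulr_ge0//.
  by have := Hk _ _ Hb; lra.
exists g; split=> //; first exact: linear_normP.
move=> d Bd; have : g (d - a) <= c - phi d; last lra.
apply: gC; exists 1, d, (phi d); split=> //; first exact: graph_hull_sub.
  by rewrite scale1r.
by rewrite mul1r.
Qed.

(* The least concave [k]-Lipschitz majorant of [phi] on [B]. *)
Definition envelope (B : set V) (phi : V -> R) (k : R) (y : V) : R :=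
  sup [set br.2 - k * `|y - br.1| |
    br in [set br : V * R | graph_hull B phi br.1 br.2]].

Section Envelope.
Variables (B : set V) (phi : V -> R) (k M : R).
Hypotheses (B0 : B !=set0) (k0 : 0 <= k) (phiM : forall d, B d -> phi d <= M).
Let psi := envelope B phi k.
Let H := graph_hull B phi.

Lemma graph_hull_le b t : H b t -> t <= M.
Proof.
move=> Hb; have : t + 0 <= M; last by rewrite addr0.
apply: (@graph_hull_affine B phi (fun=> 0) M _ _ b t) => //.
- by move=> t' x y; rewrite scaler0 addr0.
- by move=> d /phiM; rewrite addr0.
Qed.

Lemma envelope_ge b t y : H b t -> t - k * `|y - b| <= psi y.
Proof.
move=> Hb; apply: ub_le_sup; last by exists (b, t).
exists M => _ [[c s] /= /graph_hull_le sM <-].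
have : 0 <= k * `|y - c| by rewrite mulr_ge0.
lra.
Qed.

Lemma envelope_le c y : (forall b t, H b t -> t - k * `|y - b| <= c) ->
  psi y <= c.
Proof.
move=> Hc; apply: ge_sup.
  have [b Bb] := B0; exists (phi b - k * `|y - b|), (b, phi b) => //=.
  exact: graph_hull_sub.
by move=> _ [[b t] /= Hb <-]; exact: Hc.
Qed.

Lemma envelope_sub d : B d -> phi d <= psi d.
Proof.
move=> Bd; have := envelope_ge d (@graph_hull_sub _ phi _ Bd).
by rewrite subrr normr0 mulr0 subr0.
Qed.

Lemma envelope_leM y : psi y <= M.
Proof.
apply: envelope_le => b t /graph_hull_le.
have : 0 <= k * `|y - b| by rewrite mulr_ge0.
lra.
Qed.

Lemma envelope_lipschitz x y : psi x <= psi y + k * `|x - y|.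
Proof.
apply: envelope_le => b t /(envelope_ge y).
have := ler_wpM2l k0 (ler_distD x y b).
by rewrite [`|y - x|]distrC mulrDr; lra.
Qed.

Lemma envelope_continuous : continuous psi.
Proof. exact: le_lipschitz_continuous envelope_lipschitz. Qed.

Lemma envelope_concave (t : R) x y : 0 <= t -> t <= 1 ->
  t * psi x + (1 - t) * psi y <= psi (t *: x + (1 - t) *: y).
Proof.
move=> t0 t1; set p := psi (_ + _).
have t1' : 0 <= 1 - t by rewrite subr_ge0.
have Hp b r c s : H b r -> H c s ->
    t * (r - k * `|x - b|) + (1 - t) * (s - k * `|y - c|) <= p.
  move=> Hb Hc.
  have := envelope_ge (t *: x + (1 - t) *: y) (graph_hull_convex t0 t1 Hb Hc).
  have : `|(t *: x + (1 - t) *: y) - (t *: b + (1 - t) *: c)| <=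
      t * `|x - b| + (1 - t) * `|y - c|.
    rewrite opprD addrACA -!scalerBr; apply: le_trans (ler_normD _ _) _.
    by rewrite !normrZ !ger0_norm.
  move=> /(ler_wpM2l k0); rewrite -/p; lra.
(* The endpoints are set apart because the two suprema, over [(c, s)] and then over [(b, r)], are
   extracted by dividing by [1 - t] and by [t]. *)
have [t00|t00] := eqVneq t 0.
  by rewrite /p t00 mul0r add0r subr0 mul1r scale0r add0r scale1r.
have [t11|t11] := eqVneq t 1.
  by rewrite /p t11 subrr mul0r addr0 mul1r scale0r addr0 scale1r.
have tp : 0 < t by rewrite lt_neqAle eq_sym t00.
have tp' : 0 < 1 - t by rewrite subr_gt0 lt_neqAle t11.
rewrite -lerBrDl mulrC -ler_pdivlMr//; apply: envelope_le => c s Hc.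
rewrite ler_pdivlMr// lerBrDl addrC -lerBrDl mulrC -ler_pdivlMr//.
apply: envelope_le => b r Hb.
rewrite ler_pdivlMr//; have := Hp _ _ _ _ Hb Hc; lra.
Qed.

End Envelope.
End GraphHull.

(** * Small slices in spaces with the Radon-Nikodym property *)

Lemma convex_setP (K : numDomainType) (V : lmodType K) (C : set V) :
  convex_set C -> forall (t : K) x y, 0 <= t -> t <= 1 -> C x -> C y ->
    C (t *: x + (1 - t) *: y).
Proof.
move=> cC t x y t0 t1 Cx Cy.
by have := cC x y (Itv01 t0 t1) (mem_set Cx) (mem_set Cy); rewrite inE.
Qed.

Section SmallSlice.
Variables (R : realType) (V : completeNormedModType R).
Variables (D : set V) (phi : V -> R) (rho M eta delta : R).
Hypotheses (D0 : D !=set0) (Drho : forall d, D d -> `|d| <= rho).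
Hypotheses (phiM : forall d, D d -> phi d <= M).
Hypotheses (eta0 : 0 < eta) (delta0 : 0 < delta).

Let psi := envelope D phi eta.

Definition small_slice : Prop := exists (g : V -> R) (a : V) (s : R),
  [/\ linear (g : V -> R^o), forall x, `|g x| <= eta * `|x|,
    exists2 d, D d & s < phi d + g d &
    forall d, D d -> s < phi d + g d -> `|d - a| < delta].

Let far a := [set d | D d /\ delta <= `|d - a|].

(** Otherwise separation gives [g] with [phi + g <= c + g a] on the far part, so the slice above the
    level [c + g a] stays within [delta] of [a]. It is nonempty: the same inequality on all of [D]
    would give [psi a <= c]. *)
Lemma no_small_slice_hull : ~ small_slice -> forall a c, c < psi a ->
  exists b t, graph_hull (far a) phi b t /\ c + eta * `|b - a| < t.
Proof.
move=> noslice a c cpsi; apply: contrapT => nobt; apply: noslice.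
have etaW := ltW eta0.
have Hle b t : graph_hull (far a) phi b t -> t <= c + eta * `|b - a|.
  by move=> Hb; rewrite leNgt; apply/negP => lt; apply: nobt; exists b, t.
have [far0|/set0P far0] := eqVneq (far a) set0.
  (* All of [D] is within [delta] of [a], so any nonempty slice works. *)
  have [d Dd] := D0; exists (fun=> 0), a, (phi d - 1); split.
  - by move=> t x y; rewrite scaler0 addr0.
  - by move=> x; rewrite normr0 mulr_ge0.
  - by exists d => //; lra.
  - move=> e De _; rewrite ltNge; apply/negP => le.
    by have : far a e by []; rewrite far0.
have [g [lg gn gc]] := graph_hull_separation far0 etaW Hle.
have [gD _ gN] := linear_formP lg.
exists g, a, (c + g a); split=> //; last first.
  move=> d Dd lt; rewrite ltNge; apply/negP => le.
  by have := gc d (conj Dd le); rewrite gD gN; lra.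
apply: contrapT => nod; move: cpsi; apply/negP; rewrite -leNgt.
apply: (envelope_le D0) => b t Hb.
have : t + g b <= c + g a.
  apply: graph_hull_affine Hb => // d Dd.
  by rewrite leNgt; apply/negP => lt; apply: nod; exists d.
have := gn (a - b); rewrite gD gN ler_norml => /andP[_]; lra.
Qed.

Let flat k a := forall x, psi x <= psi a + k * `|x - a|.
(** The slope varies with the point: flatness for [k1] leaves room for some [k2] between [k1] and
    [eta / 2], and points flat for [k2] still belong to [A]. *)
Let A := [set a | exists k, [/\ 0 < k, k < eta / 2 & flat k a]].

Lemma flat_above k x0 : 0 < k ->
  exists x1, psi x0 + k * `|x1 - x0| <= psi x1 /\ flat k x1.
Proof.
have etaW := ltW eta0; move=> k0.
apply: (@ekeland _ _ psi M) => //.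
  exact: (envelope_continuous D0 etaW phiM).
by move=> x; exact: (envelope_leM D0 etaW phiM).
Qed.

Lemma flat_nonempty : A !=set0.
Proof.
have eta4 : 0 < eta / 4 by rewrite divr_gt0.
have [a [_ fa]] := flat_above 0 eta4.
by exists a, (eta / 4); split=> //; lra.
Qed.

(** Far away [psi] decreases with slope [eta], since the hull lies over the ball of radius [rho],
    whereas flatness at [a] allows only a drop of slope below [eta / 2] from a point of [D]. *)
Lemma flat_bounded : bounded_set A.
Proof.
have etaW := ltW eta0.
have [d Dd] := D0.
exists (2 * (M - phi d + 2 * eta * rho) / eta); split; first exact: num_real.
move=> N /ltW ltN a [k [k0 k2 fa]]; apply: le_trans ltN.
rewrite ler_pdivlMr//.
have psia : psi a <= M + eta * rho - eta * `|a|.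
  apply: (envelope_le D0) => b t Hb.
  have := graph_hull_le phiM Hb.
  have : `|b| <= rho.
    have /Hb : convex_graph (fun (b : V) (_ : R) => `|b| <= rho); last exact.
    move=> s x _ y _ s0 s1 xr yr.
    apply: le_trans (ler_normD _ _) _; rewrite !normrZ !ger0_norm ?subr_ge0//.
    have := ler_wpM2l s0 xr.
    have s1' : 0 <= 1 - s by rewrite subr_ge0.
    have := ler_wpM2l s1' yr; lra.
  move=> /(ler_wpM2l etaW).
  have /(ler_wpM2l etaW) : `|a| <= `|a - b| + `|b|.
    by have := ler_normD (a - b) b; rewrite subrK.
  lra.
have : phi d <= psi d by exact: (envelope_sub etaW phiM Dd).
have := fa d.
have : k * `|d - a| <= eta / 2 * (rho + `|a|).
  apply: ler_pM => //; [exact: ltW|exact: ltW|].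
  by apply: le_trans (ler_normB _ _) _; rewrite lerD2r Drho.
have : 0 <= eta * rho.
  by rewrite mulr_ge0//; apply: le_trans (Drho Dd).
lra.
Qed.

(* In [Psi b s], [b] is a barycenter of points [d] and [s] is the corresponding
   mean of the displacements [`|d' - d|]. *)
Lemma no_small_slice_approx k1 k2 a (Psi : V -> R -> Prop) :
  ~ small_slice -> 0 < k1 -> k1 < k2 -> k2 < eta / 2 -> flat k1 a ->
  convex_graph Psi ->
  (forall d d', D d -> delta <= `|d - a| -> flat k2 d' -> Psi d `|d' - d|) ->
  forall e, 0 < e -> exists b s, [/\ Psi b s, 0 <= s <= e & `|b - a| <= e].
Proof.
move=> noslice k10 k12 k2e fa cPsi DPsi e e0.
have etaW := ltW eta0.
have k20 : 0 < k2 by lra.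
pose e' := e * (k2 - k1).
have e'0 : 0 < e' by rewrite mulr_gt0 ?subr_gt0.
have [|b [t [Hb tgt]]] := @no_small_slice_hull noslice a (psi a - e').
  lra.
(* [b'] is the barycenter of the flat points reached from the points [d]: it lies within the mean
   displacement [s] of [b], and by concavity [psi b'] exceeds the mean [t] by at least [k2 * s]. *)
pose C b t := exists s b', [/\ Psi b s, 0 <= s, `|b' - b| <= s &
  t + k2 * s <= psi b'].
have /Hb [] : convex_graph C.
  move=> u x r y r' u0 u1 [s [x' [Ps s0 xs psix]]] [s' [y' [Ps' s'0 ys psiy]]].
  have u1' : 0 <= 1 - u by rewrite subr_ge0.
  exists (u * s + (1 - u) * s'), (u *: x' + (1 - u) *: y'); split.
  - exact: cPsi.
  - by rewrite addr_ge0// mulr_ge0.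
  - rewrite opprD addrACA -!scalerBr; apply: le_trans (ler_normD _ _) _.
    by rewrite !normrZ !ger0_norm// lerD// ler_wpM2l.
  - have := envelope_concave D0 etaW phiM x' y' u0 u1; rewrite -/psi.
    have := ler_wpM2l u0 psix; have := ler_wpM2l u1' psiy; lra.
- move=> d [Dd dd].
  have [d' [le fd]] := flat_above d k20.
  exists `|d' - d|, d'; split=> //; first exact: DPsi.
  by apply: le_trans le; rewrite lerD2r; exact: (envelope_sub etaW phiM Dd).
move=> s [b' [Ps s0 bs psib]]; exists b, s.
have : psi b' <= psi a + k1 * (s + `|b - a|).
  apply: le_trans (fa b') _; rewrite lerD2l ler_wpM2l ?(ltW k10)//.
  by apply: le_trans (ler_distD b _ _) _; rewrite lerD2r.
(* The rise [k2 * s] is set against the bound from flatness of [a], and [t] exceeds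
   [psi a - e' + eta * |b - a|]. Both remaining coefficients are at least [k2 - k1], whence the
   choice of [e']. *)
move=> le1; have le2 : (k2 - k1) * s + (eta - k1) * `|b - a| <= e' by lra.
have k12' : 0 < k2 - k1 by rewrite subr_gt0.
have n0 := normr_ge0 (b - a).
have le3 : (k2 - k1) * `|b - a| <= (eta - k1) * `|b - a|.
  by rewrite ler_wpM2r//; lra.
have p1 : 0 <= (k2 - k1) * s by rewrite mulr_ge0// ltW.
have p2 : 0 <= (k2 - k1) * `|b - a| by rewrite mulr_ge0// ltW.
have ee : e' = (k2 - k1) * e by rewrite mulrC.
split=> //; rewrite ?s0 /= -(ler_pM2l k12') -ee; lra.
Qed.

(** Without a small slice, each flat [a] lies in every closed convex [C] containing the flat points
    at distance at least [delta / 2] from [a], against dentability of [A]. *)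
Lemma rnp_small_slice : radon_nikodym_property V -> small_slice.
Proof.
move=> rnp; apply: contrapT => noslice.
have d20 : 0 < delta / 2 by rewrite divr_gt0.
have [a Aa] := rnp A flat_nonempty flat_bounded _ d20.
apply=> C [[clC cvxC] AC].
have [k1 [k10 k1e fa]] := Aa.
pose k2 := (k1 + eta / 2) / 2.
have k12 : k1 < k2 by rewrite /k2; lra.
have k2e : k2 < eta / 2 by rewrite /k2; lra.
have k20 : 0 < k2 by lra.
have flatA d' : flat k2 d' -> A d' by move=> fd; exists k2.
(* If all flat points were near [a], each far [d] would move by more than [delta / 2], and the mean
   displacement could not drop to [delta / 4]. *)
have [a0 [Aa0 a0a]] : exists a0, A a0 /\ delta / 2 <= `|a0 - a|.
  apply: contrapT => noa0.
  have [|d d' Dd dd fd||b [s [bs /andP[_ sd] _]]] :=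
    @no_small_slice_approx k1 k2 a (fun _ s => delta / 2 <= s)
      noslice k10 k12 k2e fa _ _ (delta / 4).
  - move=> u _ r _ r' u0 u1 xr yr'.
    have u1' : 0 <= 1 - u by rewrite subr_ge0.
    have := ler_wpM2l u0 xr; have := ler_wpM2l u1' yr'; lra.
  - have : `|d' - a| < delta / 2.
      rewrite ltNge; apply/negP => le; apply: noa0; exists d'; split=> //.
      exact: flatA.
    by have := ler_distD d' d a; rewrite [`|d - d'|]distrC; lra.
  - by rewrite divr_gt0.
  - by lra.
have Ca0 : C a0.
  by apply: AC; split=> //= lt; move: a0a; rewrite leNgt lt.
have rho0 : 0 <= rho by have [d /Drho] := D0; apply: le_trans.
(* With this [L], each far [d] is within [L * |d' - d|] of a point of [C]: [d'] itself if it is far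
   from [a], and otherwise [a0], since then the displacement is at least [delta / 2]. *)
pose L := 1 + (`|a0| + rho) / (delta / 2).
have L1 : 1 <= L by rewrite lerDl divr_ge0 ?addr_ge0// ltW.
have Ld : `|a0| + rho <= L * (delta / 2).
  by rewrite mulrDl mul1r divfK ?gt_eqF// lerDr ltW.
have approx e : 0 < e -> exists2 c, C c & `|c - a| < e.
  (* The distance is at most [L * e'] from [c] to [b] plus [e'] from [b] to [a], that is,
     [e / 2]. *)
  move=> e0; pose e' := e / (2 * (L + 1)).
  have e'0 : 0 < e' by rewrite divr_gt0// mulr_gt0//; lra.
  have [|d d' Dd dd fd|//|b [s [[c Cc cb] /andP[s0 se] be]]] :=
    @no_small_slice_approx k1 k2 a
      (fun b s => exists2 c, C c & `|c - b| <= L * s)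
      noslice k10 k12 k2e fa _ _ e'.
  - move=> u x r y r' u0 u1 [c Cc cx] [c' Cc' cy].
    have u1' : 0 <= 1 - u by rewrite subr_ge0.
    exists (u *: c + (1 - u) *: c'); first exact: convex_setP.
    rewrite opprD addrACA -!scalerBr; apply: le_trans (ler_normD _ _) _.
    rewrite !normrZ !ger0_norm//.
    have := ler_wpM2l u0 cx; have := ler_wpM2l u1' cy; lra.
  - have [lt|le] := ltP `|d' - a| (delta / 2); last first.
      exists d'; last by rewrite -[leLHS]mul1r ler_wpM2r.
      apply: AC; split=> /=; first exact: flatA.
      by move=> lt; move: le; rewrite leNgt lt.
    exists a0 => //; apply: le_trans (ler_normB _ _) _.
    apply: (@le_trans _ _ (`|a0| + rho)); first by rewrite lerD2l Drho.
    apply: le_trans Ld _; rewrite ler_wpM2l//; first lra.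
    by have := ler_distD d' d a; rewrite [`|d - d'|]distrC; lra.
  exists c => //.
  have L0 : 0 <= L by lra.
  have := ler_distD b c a; have := ler_wpM2l L0 se.
  have -> : e = 2 * ((L + 1) * e') by rewrite /e'; field; lra.
  have : 0 < (L + 1) * e' by rewrite mulr_gt0//; lra.
  lra.
move/closure_id : clC => ->.
move=> U /nbhs_ballP[e e0 eU].
have [c Cc ca] := approx e e0.
by exists c; split=> //; apply: eU; rewrite -ball_normE /= distrC.
Qed.

End SmallSlice.

(** * Stegall's variational principle *)

Section Stegall.
Variables (R : realType) (V : completeNormedModType R).
Hypothesis rnp : radon_nikodym_property V.
Variables (D : set V) (phi : V -> R) (rho M : R).
Hypotheses (D0 : D !=set0) (Drho : forall d, D d -> `|d| <= rho).
Hypotheses (phiM : forall d, D d -> phi d <= M).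

Let slice (gs : (V -> R) * R) d := D d /\ gs.2 < phi d + gs.1 d.
Let proper gs := [/\ linear (gs.1 : V -> R^o), slice gs !=set0 &
  exists N, forall d, D d -> phi d + gs.1 d <= N].

(** The tilt [h] changes values on [D] by at most a quarter of the excess [tau] of [d1] over [s], so
    a level of at least [s + tau / 2] keeps the new slice inside the old one. *)
Lemma refine_slice gs e : proper gs -> 0 < e -> exists gs' : (V -> R) * R,
  [/\ proper gs', forall x, `|gs'.1 x - gs.1 x| <= e * `|x|,
    slice gs' `<=` slice gs,
    exists a, forall d, slice gs' d -> `|d - a| < e &
    forall d, D d -> phi d + gs'.1 d <= gs'.2 + e].
Proof.
case: gs => g s [/= lg [d1 [/= Dd1 sd1]] [N gN]] e0.
pose tau := phi d1 + g d1 - s.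
have tau0 : 0 < tau by rewrite subr_gt0.
have rho0 : 0 <= rho by apply: le_trans (Drho Dd1).
have rho1 : 0 < 4 * (rho + 1) by rewrite mulr_gt0// ltr_wpDl.
pose c := Num.min e (tau / (4 * (rho + 1))).
have c0 : 0 < c by rewrite lt_min e0 divr_gt0.
have ce : c <= e by rewrite ge_min lexx.
have ctau : c * rho <= tau / 4.
  apply: (@le_trans _ _ (tau / (4 * (rho + 1)) * (rho + 1))).
    by apply: ler_pM => //; rewrite ?(ltW c0) ?ge_min ?lexx ?orbT ?lerDl.
  by rewrite le_eqVlt; apply/orP; left; apply/eqP; field; lra.
have [h [a [s1 [lh hc [d2 Dd2 sd2] sa]]]] :=
  @rnp_small_slice _ _ D (fun d => phi d + g d) rho N c e D0 Drho gN c0 e0 rnp.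
have hD d : D d -> `|h d| <= tau / 4.
  move=> Dd; apply: le_trans (hc d) (le_trans _ ctau).
  by rewrite ler_wpM2l ?Drho// ltW.
pose S := [set phi d + g d + h d | d in D].
have hsS : has_sup S.
  split; first by exists (phi d1 + g d1 + h d1), d1.
  exists (N + tau / 4) => _ [d Dd <-]; apply: lerD; first exact: gN.
  by apply: le_trans (hD d Dd); exact: ler_norm.
have [_ [d3 Dd3 <-] sd3] := sup_adherent e0 hsS.
have sd1' : s + tau / 2 < phi d1 + g d1 + h d1.
  by have := hD d1 Dd1; rewrite ler_norml /tau; move: tau0; rewrite /tau; lra.
(* The three levels give small diameter, inclusion in the old slice and near-maximality; they are
   exceeded at [d2], [d1] and [d3] respectively, so one of these points exceeds the maximum. *)
pose s' := Num.max (Num.max s1 (s + tau / 2)) (sup S - e).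
have s's1 : s1 <= s' by rewrite /s' !le_max lexx.
have s's2 : s + tau / 2 <= s' by rewrite /s' !le_max lexx orbT.
have s's3 : sup S - e <= s' by rewrite /s' !le_max lexx !orbT.
exists (fun x => g x + h x, s'); split=> /=.
- split=> /=.
  + by move=> t x y /=; rewrite lg lh scalerDr addrACA.
  + rewrite /slice /s' /=.
    have [_|_] := leP (Num.max s1 (s + tau / 2)) (sup S - e).
      by exists d3; split=> //; rewrite addrA.
    by have [_|_] := leP s1 (s + tau / 2);
      [exists d1|exists d2]; split=> //; rewrite addrA.
  + by exists (sup S) => d Dd; apply: ub_le_sup; [exact: hsS.2|
      exists d => //; rewrite addrA].
- by move=> x; rewrite addrC addKr; apply: le_trans (hc x) _; rewrite ler_wpM2r.
- move=> d [/= Dd sd]; split=> //=.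
  by have := hD d Dd; rewrite ler_norml; lra.
- by exists a => d [/= Dd sd]; apply: sa => //; lra.
- move=> d Dd; have : phi d + (g d + h d) <= sup S; last lra.
  by apply: ub_le_sup; [exact: hsS.2|exists d => //; rewrite addrA].
Qed.

Theorem stegall eps : continuous phi -> 0 < eps ->
  exists (g : V -> R) (u : nat -> V) (y : V),
    [/\ linear (g : V -> R^o), forall x, `|g x| <= eps * `|x|,
      (forall n, D (u n)) /\ u @ \oo --> y &
      forall d, D d -> phi d + g d <= phi y + g y].
Proof.
move=> cphi eps0.
(* The terms sum to [eps], and the tail from [n] on is [2 * e n]. *)
pose e := geometric (eps / 2) 2^-1 : nat -> R.
have e0 n : 0 < e n by rewrite /e /= mulr_gt0 ?divr_gt0// exprn_gt0// invr_gt0.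
have eS n : e n.+1 = e n / 2 by rewrite /e /= exprSr mulrA.
have ecvg : e @ \oo --> 0.
  by apply: cvg_geometric; rewrite ger0_norm ?invr_ge0// invf_lt1// ltr1n.
have /choice[f fP] : forall n_gs : nat * ((V -> R) * R), exists gs',
    proper n_gs.2 -> [/\ proper gs',
    forall x, `|gs'.1 x - n_gs.2.1 x| <= e n_gs.1 * `|x|,
    slice gs' `<=` slice n_gs.2,
    exists a, forall d, slice gs' d -> `|d - a| < e n_gs.1 &
    forall d, D d -> phi d + gs'.1 d <= gs'.2 + e n_gs.1].
  move=> [n gs]; have [pgs|npgs] := pselect (proper gs); last by exists gs.
  by have [gs' gs'P] := refine_slice pgs (e0 n); exists gs'.
have [d0 Dd0] := D0.
pose st := nat_rect (fun=> ((V -> R) * R)%type) (fun=> 0, phi d0 - 1)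
  (fun n gs => f (n, gs)).
have pst n : proper (st n).
  elim: n => [|n /(fP (n, _))[]//]; split=> /=.
  - by move=> t x y; rewrite scaler0 addr0.
  - by exists d0; split=> //=; lra.
  - by exists M => d /phiM; rewrite addr0.
pose gn n := (st n).1.
have stP n := fP (n, st n) (pst n).
have gS n x : `|gn n.+1 x - gn n x| <= e n * `|x|.
  by have [_ + _ _ _] := stP n; apply.
have slS n m : (n <= m)%N -> slice (st m) `<=` slice (st n).
  elim: m => [|m IH]; first by rewrite leqn0 => /eqP ->.
  rewrite leq_eqVlt => /orP[/eqP ->//|/IH]; apply: subset_trans.
  by have [_ _ + _ _] := stP m; apply.
have gnm n m x : (n <= m)%N ->
    `|gn m x - gn n x| <= (2 * e n - 2 * e m) * `|x|.
  elim: m => [|m IH].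
    by rewrite leqn0 => /eqP ->; rewrite !subrr normr0 mul0r.
  rewrite leq_eqVlt => /orP[/eqP ->|/IH le].
    by rewrite !subrr normr0 mul0r.
  have := ler_distD (gn m x) (gn m.+1 x) (gn n x).
  by have := gS m x; rewrite eS; lra.
have gcvg x : cvgn (fun n => gn n x).
  apply/cauchy_cvgP; apply: cauchy_exP => r r0.
  have /cvgrPdist_lt/(_ (r / (2 * (`|x| + 1)))) := ecvg.
  have x1 : 0 < 2 * (`|x| + 1) by rewrite mulr_gt0// ltr_wpDl.
  rewrite divr_gt0// => /(_ isT)[n _ /(_ n (leqnn n))] /=.
  rewrite sub0r normrN gtr0_norm// ltr_pdivlMr// => en.
  exists (gn n x); exists n => // m /= nm; rewrite -ball_normE /= distrC.
  apply: le_lt_trans (gnm n m x nm) _; apply: le_lt_trans en.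
  have := e0 n; have := e0 m; have := normr_ge0 x => x0 em en.
  have : 0 <= e m * `|x| by rewrite mulr_ge0// ltW.
  lra.
pose g x := limn (fun n => gn n x).
have gncvg x : gn n x @[n --> \oo] --> g x by exact: gcvg.
have ggn n x : `|g x - gn n x| <= 2 * e n * `|x|.
  have c1 : `|gn m x - gn n x| @[m --> \oo] --> `|g x - gn n x|.
    by apply: cvg_norm; apply: cvgB => //; exact: cvg_cst.
  apply: (ler_cvg_to c1 (cvg_cst _)); exists n => // m nm.
  apply: le_trans (gnm n m x nm) _; rewrite ler_wpM2r//.
  by have := e0 m; lra.
have lg : linear (g : V -> R^o).
  move=> t x y; apply: cvg_lim => //.
  have -> : (fun n => gn n (t *: x + y)) =
      (fun n => t *: (gn n x : R^o) + gn n y).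
    by apply/funext => n; have [lgn _ _] := pst n; rewrite /gn lgn.
  by apply: cvgD => //; apply: cvgZr.
have gle x : `|g x| <= eps * `|x|.
  have := ggn 0 x; rewrite /gn /= subr0 /e /= expr0 mulr1.
  by rewrite (mulrC 2) divfK.
have /choice[u uP] : forall n, exists d, slice (st n) d.
  by move=> n; have [_ [d sd] _] := pst n; exists d.
have ucvg : cvgn u.
  apply/cauchy_cvgP; apply: cauchy_exP => r r0.
  have /cvgrPdist_lt/(_ r r0)[n _ /(_ n (leqnn n))] /= := ecvg.
  rewrite sub0r normrN gtr0_norm// => en.
  have [_ _ _ [a aP] _] := stP n.
  exists a; exists n.+1 => // m nm /=; rewrite -ball_normE /= distrC.
  apply: lt_trans en; apply: aP; exact: slS nm _ (uP m).
pose y := limn u.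
have uy : u @ \oo --> y by exact: ucvg.
exists g, u, y; split=> //; first by split=> // n; have [] := uP n.
move=> d Dd.
have cg : continuous g.
  apply: (@le_lipschitz_continuous _ _ _ eps); first exact: ltW.
  have [gD _ gN] := linear_formP lg.
  by move=> x z; have := gle (x - z); rewrite gD gN ler_norml; lra.
have c1 : phi (u n) + g (u n) + e n * (4 * rho + 2) @[n --> \oo] -->
    phi y + g y + 0 * (4 * rho + 2).
  apply: cvgD; last by apply: cvgM => //; exact: cvg_cst.
  by apply: cvgD; [apply: cvg_comp uy _; exact: cphi|
    apply: cvg_comp uy _; exact: cg].
rewrite mul0r addr0 in c1.
(* [stP n] describes [st n.+1] with error [e n = 2 * e n.+1]; replacing [gn n.+1] by [g] at [d] and
   at [u n.+1] costs [4 * e n.+1 * rho] in all. *)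
apply: (ler_cvg_to (cvg_cst _) c1); exists 1%N => // -[//|n] _ /=.
have [_ _ _ _ /(_ _ Dd)] := stP n; rewrite -/(st n.+1) -/(gn n.+1) => le1.
have [Du] := uP n.+1; rewrite -/(gn n.+1) => le2.
have := ggn n.+1 d; have := ggn n.+1 (u n.+1).
have en0 : 0 <= 2 * e n.+1 by rewrite mulr_ge0// ltW.
have := ler_wpM2l en0 (Drho Dd); have := ler_wpM2l en0 (Drho Du).
have : e n = 2 * e n.+1 by rewrite eS; lra.
rewrite !ler_norml; lra.
Qed.

End Stegall.

(** * Density of quasi norm attaining polynomials *)

Section QuasiNormAttainment.
Variable K : numFieldType.

(** Compactness of the unimodular scalars, one of the two facts established separately for each
    field; [n <= f n] already carries limits along [f]. *)
Definition unit_sequences_subconverge : Prop := forall l : nat -> K,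
  (forall n, `|l n| = 1) -> exists (f : nat -> nat) (m : K),
    (forall n, (n <= f n)%N) /\ (l \o f) @ \oo --> m.

(** The other such fact: Stegall's principle for the norm on a set invariant under unimodular
    multiples, which allows [|F d|] in place of a real part. *)
Definition perturbed_norm_attains (Y : normedModType K) : Prop :=
  forall (D : set Y) (rho : K), D !=set0 -> (forall d, D d -> `|d| <= rho) ->
    (forall l d, `|l| = 1 -> D d -> D (l *: d)) ->
    forall e, 0 < e -> exists (F : Y -> K) (u : nat -> Y) (y : Y),
      [/\ linear (F : Y -> K^o), forall x, `|F x| <= e * `|x|,
        (forall n, D (u n)) /\ u @ \oo --> y &
        forall d, D d -> `|d| + `|F d| <= `|y| + `|F y|].

(** [supremum 0] takes the default value 0 on the empty set and on sets without a supremum; hence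
    the hypothesis [0 <= b]. *)
Lemma supremum_le (A : set K) (b : K) : 0 <= b -> (forall a, A a -> a <= b) ->
  supremum 0 A <= b.
Proof.
move=> b0 Ab; rewrite /supremum; case: ifP => // _.
by case: xgetP => // s _ [_]; apply.
Qed.

Lemma supremum_eq (A : set K) (s : K) : A !=set0 ->
  (forall a, A a -> a <= s) ->
  (forall b, (forall a, A a -> a <= b) -> s <= b) ->
  supremum 0 A = s.
Proof.
move=> A0 As sA; have sS : supremums A s by split=> // b Ab; exact: sA.
rewrite /supremum ifF; last first.
  apply/eqP => A0'; move: A0; by rewrite A0' => -[].
case: xgetP => [t _ tS|/(_ s)//]; exact: is_subset1_supremums tS sS.
Qed.

Variables (X Y : normedModType K) (n : nat).

Lemma homogeneous_poly_bounded (P : X -> Y) : homogeneous_poly X Y n P ->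
  exists2 C, 0 < C & forall x, unit_ball X x -> `|P x| <= C.
Proof.
move=> [A [[_ [M [Mr AM]]] _ PA]].
exists (`|M| + 1) => [|x Bx]; first by rewrite ltr_wpDl.
rewrite PA; apply: (AM (`|M| + 1)) => // .
by apply: le_lt_trans (real_ler_norm Mr) _; rewrite ltrDl.
Qed.

Lemma homogeneous_poly_comp (P : X -> Y) (T : Y -> Y) (c : K) :
  linear T -> 0 <= c -> (forall y, `|T y| <= c * `|y|) ->
  homogeneous_poly X Y n P -> homogeneous_poly X Y n (T \o P).
Proof.
move=> lT c0 Tc [A [[mA [M [Mr AM]]] sA PA]].
exists (T \o A); split; last by move=> x /=; rewrite PA.
- split; first by move=> v i t x y /=; rewrite mA lT.
  exists (c * (`|M| + 1)); split; first by rewrite realM ?realD ?ger0_real.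
  move=> N /ltW ltN v Bv /=; apply: le_trans (Tc _) (le_trans _ ltN).
  rewrite ler_wpM2l//; apply: (AM (`|M| + 1)) => //.
  by apply: le_lt_trans (real_ler_norm Mr) _; rewrite ltrDl.
- by move=> s v /=; rewrite sA.
Qed.

Lemma QNA_dense : unit_sequences_subconverge -> perturbed_norm_attains Y ->
  dense_in_homogeneous_poly n (QNA X Y n).
Proof.
move=> Kcl Yatt P hP eps eps0.
have [C C0 PC] := homogeneous_poly_bounded hP.
pose D := [set y | exists l x, [/\ `|l| = 1, unit_ball X x & y = l *: P x]].
have B0 : unit_ball X 0 by rewrite /unit_ball /= normr0.
have D0 : D !=set0 by exists (1 *: P 0), 1, 0; rewrite normr1.
have DC d : D d -> `|d| <= C.
  by move=> [l [x [l1 Bx ->]]]; rewrite normrZ l1 mul1r PC.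
have DZ l d : `|l| = 1 -> D d -> D (l *: d).
  move=> l1 [m [x [m1 Bx ->]]]; exists (l * m), x.
  by rewrite normrM l1 m1 mulr1 scalerA.
(* As [C] bounds [P] on the ball, [F \o P] will be at most [eps / 2] there, which keeps the final
   inequality strict after the supremum. *)
have e0 : 0 < eps / (2 * C) by rewrite divr_gt0// mulr_gt0.
have [F [u [y [lF Fe [Du uy] ymax]]]] := Yatt D C D0 DC DZ _ e0.
have [_ FZ _] := linear_formP lF.
(* Makes [F y *: z] the multiple of [y] by [|F y| / |y|]; if [F y = 0], the coefficient vanishes and
   [z = 0]. *)
pose z := (`|F y| / (F y * `|y|)) *: y.
have y_neq0 : F y != 0 -> `|y| != 0.
  apply: contra => /eqP y0; rewrite -normr_eq0 eq_le normr_ge0 andbT.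
  by have := Fe y; rewrite y0 mulr0.
have z1 : `|z| <= 1.
  rewrite /z normrZ !normrM normfV !normrM !normr_id.
  have [->|Fy0] := eqVneq (F y) 0; first by rewrite normr0 !mul0r.
  have y0 := y_neq0 Fy0; have Fyn : `|F y| != 0 by rewrite normr_eq0.
  by rewrite invfM mulrA divff// mul1r mulVf.
pose T x := x + F x *: z.
have lT : linear T.
  move=> t a b; rewrite /T lF scalerDl -[t *: F a]/(t * F a) -scalerA.
  by rewrite scalerDr addrACA.
have Tle x : `|T x| <= `|x| + `|F x|.
  apply: le_trans (ler_normD _ _) _; rewrite lerD2l normrZ.
  by rewrite -[leRHS]mulr1 ler_wpM2l.
have Ty : `|T y| = `|y| + `|F y|.
  rewrite /T /z; have [->|Fy0] := eqVneq (F y) 0.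
    by rewrite scale0r addr0 normr0 addr0.
  have y0 := y_neq0 Fy0.
  rewrite scalerA invfM mulrCA mulVKf// -[X in X + _]scale1r -scalerDl normrZ.
  rewrite ger0_norm ?addr_ge0 ?divr_ge0// mulrDl mul1r divfK//.
have TZ t x : T (t *: x) = t *: T x.
  by rewrite /T FZ scalerDr -scalerA.
have TB x w : T x - T w = T (x - w).
  by rewrite addrC -scaleN1r -lT scaleN1r addrC.
have Tc x : `|T x| <= (1 + eps / (2 * C)) * `|x|.
  by apply: le_trans (Tle x) _; rewrite mulrDl mul1r lerD2l.
have c0 : 0 < 1 + eps / (2 * C) by rewrite addr_gt0.
have hQ : homogeneous_poly X Y n (T \o P).
  exact: homogeneous_poly_comp lT (ltW c0) Tc hP.
have /choice[lx lxP] : forall k, exists lx : K * X,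
    [/\ `|lx.1| = 1, unit_ball X lx.2 & u k = lx.1 *: P lx.2].
  by move=> k; have [l [x lxP]] := Du k; exists (l, x).
have [f [m [fge lm]]] := Kcl (fun k => (lx k).1)
  (fun k => let: And3 h _ _ := lxP k in h).
have m1 : `|m| = 1.
  have : `|(lx (f k)).1| @[k --> \oo] --> `|m| by exact: cvg_norm lm.
  have -> : (fun k => `|(lx (f k)).1|) = fun=> 1.
    by apply/funext => k; have [] := lxP (f k).
  by move=> /(cvg_unique (@norm_hausdorff _ _)); apply; exact: cvg_cst.
have m0 : m != 0 by rewrite -normr_eq0 m1 oner_eq0.
(* [P (x k)] is [u (f k)] divided by its unimodular factor, which tends to [m]. *)
pose w := m^-1 *: y.
have Tw : `|T w| = `|y| + `|F y|.
  by rewrite TZ normrZ normfV m1 invr1 mul1r.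
pose x k := (lx (f k)).2.
have Bx k : unit_ball X (x k) by have [] := lxP (f k).
have Pxw : (P \o x) @ \oo --> w.
  have -> : P \o x = fun k => (lx (f k)).1^-1 *: u (f k).
    apply/funext => k /=; have [l1 _ ->] := lxP (f k).
    by rewrite scalerA mulVf ?scale1r// -normr_eq0 l1 oner_eq0.
  apply: cvgZ; first exact: cvgV.
  move=> U /uy [N _ NU]; exists N => // k /= Nk; apply: NU => /=.
  exact: leq_trans Nk (fge k).
have TPxw : (T \o P \o x) @ \oo --> T w.
  apply/cvgrPdist_lt => e e_gt0.
  have /cvgrPdist_lt/(_ (e / (1 + eps / (2 * C)))) := Pxw.
  rewrite divr_gt0// => /(_ isT); apply: filterS => k /=.
  by rewrite ltr_pdivlMr// mulrC TB; apply: le_lt_trans.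
have normQ : poly_norm (T \o P) = `|y| + `|F y|.
  apply: supremum_eq.
  - by exists `|T (P 0)|, 0.
  - move=> _ [v Bv <-]; apply: le_trans (Tle _) (ymax _ _).
    by exists 1, v; rewrite normr1 scale1r.
  - move=> b bub; rewrite -Tw.
    (* In a partial order, passing from the negation of [<=] to [<] requires real elements; [b] is
       real because it dominates a norm. *)
    have br : b \is Num.real.
      by rewrite ger0_real// (le_trans _ (bub _ (ex_intro2 _ _ 0 B0 erefl))).
    rewrite real_leNgt ?normr_real//; apply/negP => blt.
    have /cvgrPdist_lt/(_ (`|T w| - b)) := TPxw.
    rewrite subr_gt0 => /(_ blt)[N _ /(_ N (leqnn N))] /=.
    rewrite ltrBrDr; suff : `|T w| <= `|T w - T (P (x N))| + b.
      by move=> /le_lt_trans h /h; rewrite ltxx.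
    rewrite -[X in `|X| <= _](subrK (T (P (x N)))).
    apply: le_trans (ler_normD _ _) _; rewrite lerD2l.
    by apply: bub; exists (x N).
exists (T \o P).
  by do 2! split=> //; exists x, (T w); rewrite Tw normQ.
apply: (@le_lt_trans _ _ (eps / 2)); last first.
  by rewrite ltr_pdivrMr// mulrDr mulr1 ltrDl.
apply: supremum_le => [|_ [v Bv <-]]; first by rewrite divr_ge0// ltW.
rewrite /T /= opprD addrA subrr sub0r normrN normrZ.
apply: (@le_trans _ _ (`|F (P v)|)); first by rewrite -[leRHS]mulr1 ler_wpM2l.
apply: le_trans (Fe _) _.
have -> : eps / 2 = eps / (2 * C) * C by rewrite invfM mulrA divfK ?gt_eqF.
by rewrite ler_wpM2l ?PC// ltW.
Qed.

End QuasiNormAttainment.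

Lemma increasing_seq_ge (f : nat -> nat) n : increasing_seq f -> (n <= f n)%N.
Proof.
move=> fincr; elim: n => // n IH; apply: leq_ltn_trans IH _.
by have := fincr n.+1 n; rewrite !leEnat ltnn => /negbT; rewrite -ltnNge.
Qed.

(** * Real scalars *)

Section RealScalars.
Variable R : realType.

Lemma real_unit_sequences_subconverge : unit_sequences_subconverge R.
Proof.
move=> l l1.
have [|f fincr fcvg] := @bolzano_weierstrass R l.
  by exists 1; split=> // x x1 n _ /=; rewrite l1 ltW.
exists f, (limn (l \o f)); split=> // n; exact: increasing_seq_ge.
Qed.

(** Stegall's principle with the norm as [phi]; when [g d < 0], the point [- d], also in [D],
    replaces [d]. *)
Lemma real_perturbed_norm_attains (Y : completeNormedModType R) :
  radon_nikodym_property Y -> perturbed_norm_attains Y.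
Proof.
move=> rnp D rho D0 Drho DZ e e0.
have [g [u [y [lg ge uy ymax]]]] :=
  stegall rnp D0 Drho Drho (@norm_continuous _ Y) e0.
have [_ gZ _] := linear_formP lg.
exists g, u, y; split=> // d Dd.
have ymax' : forall d, D d -> `|d| + g d <= `|y| + `|g y|.
  by move=> d' /ymax le; apply: le_trans le _; rewrite lerD2l ler_norm.
have [gd|gd] := leP 0 (g d).
  by rewrite (ger0_norm gd); exact: ymax'.
have := ymax' _ (DZ _ _ (normrN1 R) Dd).
by rewrite gZ normrZ normrN1 mul1r mulN1r (ltr0_norm gd).
Qed.

End RealScalars.

(** * Complex scalars *)

Section ComplexModulus.
Variable R : realType.
Local Open Scope complex_scope.

Lemma ReD (a b : R[i]) : complex.Re (a + b) = complex.Re a + complex.Re b.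
Proof. by case: a; case: b. Qed.

Lemma ReMl (a : R) (b : R[i]) : complex.Re (a%:C * b) = a * complex.Re b.
Proof. by case: b => b c /=; rewrite mul0r subr0. Qed.

Lemma normC_real (a : R) : `|a%:C| = `|a|%:C.
Proof. by rewrite normc_def /= expr0n addr0 sqrtr_sqr. Qed.

Lemma gt0_ReK (e : R[i]) : 0 < e -> (complex.Re e)%:C = e.
Proof. by move=> e0; rewrite RRe_real// gtr0_real. Qed.

Lemma Re_gt0 (e : R[i]) : 0 < e -> 0 < complex.Re e.
Proof. by move=> e0; rewrite -ltcR gt0_ReK. Qed.

Lemma realCD (a b : R) : (a + b)%:C = a%:C + b%:C.
Proof. exact: rmorphD. Qed.

Lemma realCM (a b : R) : (a * b)%:C = a%:C * b%:C.
Proof. exact: rmorphM. Qed.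

Lemma normC_le_ReIm (z : R[i]) :
  `|z| <= (`|complex.Re z| + `|complex.Im z|)%:C.
Proof.
rewrite [z in leLHS]complexE; apply: le_trans (ler_normD _ _) _.
rewrite rmorphD lerD ?normC_real//.
by rewrite normrM normC_real normc_def /= expr0n expr1n add0r sqrtr1 mul1r.
Qed.

Lemma normC_ge_Im (z : R[i]) : `|complex.Im z|%:C <= `|z|.
Proof. by rewrite normc_def lecR -sqrtr_sqr ler_wsqrtr// lerDr sqr_ge0. Qed.

End ComplexModulus.

(** A separate type name, so that the real structure and norm do not clash with those over
    [R[i]]. *)
Definition realification (R : realType) (Y : normedModType R[i]) : Type := Y.

Section Realification.
Variables (R : realType) (Y : normedModType R[i]).
Local Open Scope complex_scope.
Local Notation YR := (realification Y).

HB.instance Definition _ := GRing.Zmodule.copy YR Y.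

Let scale (a : R) (y : YR) : YR := a%:C *: (y : Y).

Let scaleA a b v : scale a (scale b v) = scale (a * b) v.
Proof. by rewrite /scale scalerA -rmorphM. Qed.
Let scale1 : left_id 1 scale.
Proof. by move=> v; rewrite /scale rmorph1 scale1r. Qed.
Let scaleDr : right_distributive scale +%R.
Proof. by move=> a u v; rewrite /scale scalerDr. Qed.
Let scaleDl v : {morph scale^~ v : a b / a + b}.
Proof. by move=> a b; rewrite /scale rmorphD scalerDl. Qed.

HB.instance Definition _ := GRing.Zmodule_isLmodule.Build R YR
  scaleA scale1 scaleDr scaleDl.

Lemma realification_scaleE (a : R) (y : YR) : a *: y = a%:C *: (y : Y) :> Y.
Proof. by []. Qed.

Lemma normC_Re (y : Y) : (complex.Re `|y|)%:C = `|y|.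
Proof. by rewrite RRe_real// normr_real. Qed.

Let normD (x y : YR) :
  complex.Re `|(x + y : Y)| <= complex.Re `|x : Y| + complex.Re `|y : Y|.
Proof.
have /= := @ler_normD _ Y x y; rewrite lecE ReD => /andP[_]; exact.
Qed.
Let normZ (a : R) (y : YR) :
  complex.Re `|(a *: y : YR) : Y| = `|a| * complex.Re `|y : Y|.
Proof. by rewrite realification_scaleE (@normrZ _ Y) normC_real ReMl. Qed.
Let norm0 (y : YR) : complex.Re `|y : Y| = 0 -> y = 0.
Proof. by move=> y0; apply/(@normr0_eq0 _ Y); rewrite -normC_Re y0. Qed.

HB.instance Definition _ := Lmodule_isNormed.Build R YR normD normZ norm0.

Lemma realification_norm (y : YR) : `|y|%:C = `|y : Y|.
Proof. exact: normC_Re. Qed.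

Lemma realification_ball (x : YR) (e : R) :
  ball x e = [set y : YR | `|(x : Y) - (y : Y)| < e%:C].
Proof.
by apply/funext => y; rewrite -ball_normE /= -ltcR realification_norm.
Qed.

Lemma realification_nbhs (x : YR) (U : set YR) :
  nbhs (x : Y) (U : set Y) -> nbhs x U.
Proof.
move=> /nbhs_ballP[e e0 eU]; apply/nbhs_ballP; exists (complex.Re e).
  exact: Re_gt0.
move=> y; rewrite realification_ball /= gt0_ReK// => xy.
by apply: eU; rewrite -ball_normE.
Qed.

Lemma nbhs_realification (x : YR) (U : set YR) :
  nbhs x U -> nbhs (x : Y) (U : set Y).
Proof.
move=> /nbhs_ballP[e e0 eU]; apply/nbhs_ballP; exists e%:C => /=.
  by rewrite (ltcR 0).
move=> y; rewrite -ball_normE /= => xy.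
by apply: eU; rewrite realification_ball.
Qed.

(** The coefficients of complex convex combinations are real already, and both structures have the
    same closed and bounded sets, so dentability passes over. *)
Lemma realification_rnp :
  radon_nikodym_property Y -> radon_nikodym_property YR.
Proof.
move=> rnp A A0 [M [_ AM]] delta delta0.
have AM1 y : A y -> `|y| <= M + 1 by apply: AM; rewrite ltrDl.
have bA : bounded_set (A : set Y).
  exists (M + 1)%:C; split; first by rewrite complex_real.
  move=> N /ltW ltN y Ay /=; apply: le_trans ltN.
  by rewrite -realification_norm lecR; exact: AM1.
have [|a Aa na] := rnp A A0 bA delta%:C; first by rewrite (ltcR 0).
exists a => // hull; apply: na => C [[clC cvxC] AC]; apply: hull; split.
  split.
    move=> p pC; apply: clC => U /realification_nbhs; exact: pC.
  move=> x y t /set_mem Cx /set_mem Cy; apply/mem_set.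
  have := @convex_setP _ _ _ cvxC (t%:num)%:C _ _ _ _ Cx Cy.
  have -> : 1 - (t%:num)%:C = (1 - t%:num)%:C by rewrite rmorphB; congr (_ - _).
  by apply; rewrite ?(lecR 0) ?(lecR _ 1).
move=> y [Ay ny]; apply: AC; split=> //= lt; apply: ny => /=.
by rewrite -ltcR realification_norm.
Qed.

End Realification.

Section CompleteRealification.
Variables (R : realType) (Y : completeNormedModType R[i]).
Local Open Scope complex_scope.
Local Notation YR := (realification Y).

Let realification_complete (F : set_system YR) :
  ProperFilter F -> cauchy F -> cvg F.
Proof.
move=> FF /cauchyP Fc.
have /cvg_ex[l Fl] : cvg (F : set_system Y).
  apply/cauchy_cvgP; apply: cauchy_exP => e e0.
  have [x Fx] := Fc _ (Re_gt0 e0); exists x; apply: filterS Fx => y.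
  by rewrite realification_ball /= gt0_ReK// -ball_normE.
by apply/cvg_ex; exists l => U /nbhs_realification; exact: Fl.
Qed.

HB.instance Definition _ := Uniform_isComplete.Build YR realification_complete.

End CompleteRealification.
Section ComplexScalars.
Variable R : realType.
Local Open Scope complex_scope.

(** Bolzano-Weierstrass is applied to the real parts, then to the imaginary parts along the
    subsequence obtained. *)
Lemma complex_unit_sequences_subconverge : unit_sequences_subconverge R[i].
Proof.
move=> l l1.
have [|f fincr fcvg] := @bolzano_weierstrass R (fun n => complex.Re (l n)).
  exists 1; split=> // x x1 n _ /=; apply: le_trans (ltW x1).
  by rewrite -lecR; apply: le_trans (normc_ge_Re _) _; rewrite l1.
have [|h hincr hcvg] := @bolzano_weierstrass R (fun n => complex.Im (l (f n))).
  exists 1; split=> // x x1 n _ /=; apply: le_trans (ltW x1).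
  by rewrite -lecR; apply: le_trans (normC_ge_Im _) _; rewrite l1.
set a := limn _ in fcvg; set b := limn _ in hcvg.
exists (f \o h), (a +i* b); split.
  move=> n; apply: leq_trans (increasing_seq_ge n hincr) _.
  exact: increasing_seq_ge.
apply/cvgrPdist_lt => e e0.
have e2 : 0 < complex.Re e / 2 by rewrite divr_gt0// Re_gt0.
move/cvgrPdist_lt/(_ _ e2) : fcvg => [N _ NP].
move/cvgrPdist_lt/(_ _ e2) : hcvg => [M _ MP].
exists (maxn N M) => // n /=; rewrite geq_max => /andP[Nn Mn].
apply: le_lt_trans (normC_le_ReIm _) _; rewrite -[ltRHS]gt0_ReK// ltcR.
have /= := NP (h n) (leq_trans Nn (increasing_seq_ge n hincr)).
have /= := MP n Mn; case: (l (f (h n))) => p q /=; lra.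
Qed.

Lemma complex_perturbed_norm_attains (Y : completeNormedModType R[i]) :
  radon_nikodym_property Y -> perturbed_norm_attains Y.
Proof.
move=> rnp D rho D0 Drho DZ e e0.
pose YR := realification Y.
have Drho' (d : YR) : D d -> `|d| <= complex.Re rho.
  by move=> /Drho; rewrite lecE => /andP[].
have [g [u [y [lg ge [Du uy] ymax]]]] := stegall (realification_rnp rnp)
  D0 Drho' Drho' (@norm_continuous _ YR) (Re_gt0 e0).
have [gD gZ gN] := linear_formP lg.
(* The complex-linear functional with real part [g]. *)
pose F (x : Y) : R[i] := g x -i* g ('i *: x).
have lF : linear (F : Y -> R[i]^o).
  move=> t x v; rewrite /F.
  have tE (w : Y) : t *: w = ((complex.Re t)%:C *: w +
      (complex.Im t)%:C *: ('i *: w) :> Y).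
    by rewrite scalerA -scalerDl {1}[t]complexE mulrC.
  have gt (w : Y) :
      g (t *: w) = complex.Re t * g w + complex.Im t * g ('i *: w).
    by rewrite tE gD -!realification_scaleE !gZ.
  rewrite -[_ *: (_ -i* _)]/(_ * _).
  rewrite scalerDr [X in _ -i* g (X + _)]scalerA mulrC -scalerA.
  rewrite !gD !gt scalerA -expr2 sqr_i scaleN1r gN.
  by case: t {tE gt} => p q /=; congr Complex; ring.
have [_ FZ _] := linear_formP lF.
(* Rotating [x] by [l] makes [F (l *: x)] real and nonnegative, hence equal to its real part
   [g (l *: x)]. *)
have phase x : exists2 l : R[i], `|l| = 1 & `|F x| = (g (l *: x))%:C.
  have [Fx0|Fx0] := eqVneq (F x) 0.
    by exists 1; rewrite ?normr1// scale1r Fx0 normr0; case: Fx0 => ->.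
  exists (`|F x| / F x).
    by rewrite normrM normr_id normfV divff// normr_eq0.
  have := FZ (`|F x| / F x) x; rewrite divfK// => FE.
  have /gt0_ReK <- : 0 < `|F x| by rewrite normr_gt0.
  exact: (congr1 (fun z => (complex.Re z)%:C) (esym FE)).
exists F, u, y; split=> //.
- move=> x; have [l l1 ->] := phase x.
  apply: (@le_trans _ _ (complex.Re e * `|(l *: x : Y) : YR|)%:C).
    by rewrite lecR; apply: le_trans (ge _); exact: ler_norm.
  by rewrite realCM gt0_ReK// realification_norm normrZ l1 mul1r.
- split=> // U /realification_nbhs; exact: uy.
(* The real inequality is used at [l *: d], which lies in [D] and has the norm of [d]; on the right,
   [g y] is at most [|F y|]. *)
- move=> d Dd; have [l l1 ->] := phase d.
  have := ymax _ (DZ _ _ l1 Dd); rewrite -lecR !realCD !realification_norm.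
  rewrite normrZ l1 mul1r => /le_trans; apply; rewrite lerD2l.
  apply: le_trans (normc_ge_Re (F y)); rewrite lecR; exact: ler_norm.
Qed.

End ComplexScalars.

Theorem corollary3p17 (R : realType) :
  (forall (X Y : completeNormedModType R) (n : nat),
     radon_nikodym_property Y -> dense_in_homogeneous_poly n (QNA X Y n)) /\
  (forall (X Y : completeNormedModType R[i]) (n : nat),
     radon_nikodym_property Y -> dense_in_homogeneous_poly n (QNA X Y n)).
Proof.
split=> X Y n rnp; apply: QNA_dense.
- exact: real_unit_sequences_subconverge.
- exact: real_perturbed_norm_attains.
- exact: complex_unit_sequences_subconverge.
- exact: complex_perturbed_norm_attains.
Qed.
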